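(* Let $N\ge2$ and consider the opinion process on the one-dimensional graph with vertices labelled $0,1,\dots,N$ (vertex $k$ corresponding to the point $k/N$), boundary vertices $0$ and $N$ with boundary opinions $T_-:=T_0$ and $T_+:=T_N$, internal vertices $1,\dots,N-1$, and edges $\{k,k+1\}$ for $k=1,\dots,N-1$ oriented from $k$ to $k+1$ together with the edge from $1$ to $0$. Let $O^{\mathrm{stat}}=(O^{\mathrm{stat}}_k)_{k=0}^N$ be distributed according to the invariant measure $\nu^O$ of this process, and let $m(x):=T_-+x(T_+-T_-)$. Then for every $\epsilon>0$ and every continuous $\psi:[0,1]\to\mathbb R$, $\lim_{N\to\infty}\mathbb P_{\nu^O}\left(\left|\frac1N\sum_{k=0}^N\psi(k/N)O^{\mathrm{stat}}_k-\int_0^1\psi(x)m(x)\,dx\right|>\epsilon\right)=0.$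
   Context: Opinion process on a finite oriented graph $(\overline{\mathbb V},\overline E)$ with internal vertices $\mathbb V$, boundary vertices $\partial\mathbb V$, boundary edges oriented $ij$ with $i\in\mathbb V$, $j\in\partial\mathbb V$, and fixed boundary values $T_j>0$: the Markov process on $\mathbb R_+^{\overline{\mathbb V}}$ with $O_j\equiv T_j$ for $j\in\partial\mathbb V$ and generator $L^Of(O)=\sum_{ij\in\overline E}\int_0^1dv\,[f(H^O_{ij;v}O)-f(O)]$, where $(H^O_{ij;v}O)_\ell=vO_i+(1-v)O_j$ for $\ell\in\{i,j\}\cap\mathbb V$ and $(H^O_{ij;v}O)_\ell=O_\ell$ otherwise. It has a unique invariant probability measure $\nu^O$. *)

(* Defs.v *)
From HB Require Import structures.
From mathcomp Require Import all_boot all_order all_algebra.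
From mathcomp Require Import all_classical all_reals all_analysis.
Set Implicit Arguments. Unset Strict Implicit. Unset Printing Implicit Defensive.
Import Order.TTheory GRing.Theory Num.Theory.
Import numFieldNormedType.Exports.
Local Open Scope classical_set_scope.
Local Open Scope ring_scope.

Definition opinion_edges (N : nat) : seq (nat * nat) :=
  (1%N, 0%N) :: [seq (k, k.+1) | k <- iota 1 (N - 1)].

Definition opinion_update {R : realType} (N : nat) (i j : nat) (v : R)
    (O : N.+1.-tuple R) : N.+1.-tuple R :=
  [tuple (if ((val l == i) || (val l == j)) && (0 < val l < N)%N
          then v * tnth O (inord i) + (1 - v) * tnth O (inord j)
          else tnth O l) | l < N.+1].

Definition opinion_generator {R : realType} (N : nat)
    (f : N.+1.-tuple R -> R) (O : N.+1.-tuple R) : R :=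
  \sum_(e <- opinion_edges N)
     Rintegral (@lebesgue_measure R) `[0%R, 1%R]
       (fun v : R => f (@opinion_update R N e.1 e.2 v O) - f O).

Definition opinion_invariant {R : realType} (N : nat) (Tm Tp : R)
    (nu : probability (N.+1.-tuple R) R) : Prop :=
  nu [set O | tnth O ord0 = Tm /\ tnth O ord_max = Tp /\
              forall k, 0 <= tnth O k] = 1%E /\
  forall f : N.+1.-tuple R -> R,
    measurable_fun setT f ->
    (exists M : R, forall O, `|f O| <= M) ->
    Rintegral nu setT (opinion_generator f) = 0.

(* Main.v *)
(**
  Let [Y] be the deviation of the opinions from the linear profile, [G] the
  Green function of the discrete Dirichlet Laplacian and [P = G Y].  The energy
  [F = <Y, P> + 2 N |Y|^2] satisfies [L F <= 2 (Tp - Tm)^2 - |Y|^2]: on each edge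
  the fluctuation created by the averaging step is absorbed by the dissipation
  of [2 N |Y|^2], and summation by parts turns the first term into [- |Y|^2].
  Invariance then formally gives [E |Y|^2 <= 2 (Tp - Tm)^2] uniformly in [N], so
  the mean of [psi Y] is of order [N^(-1/2)], and a Riemann sum is left.

  As [F] is unbounded and no moment of [nu] is known beforehand, invariance is
  applied to the bounded increasing concave function [- 1 / (r + F)] of [F] and
  [r] is sent to infinity, which still yields a weak-type bound on [|Y|^2].
*)

Require Import Defs.
From HB Require Import structures.
From mathcomp Require Import all_boot all_order all_algebra.
From mathcomp Require Import all_classical all_reals all_analysis.
From mathcomp Require Import measurable_realfun.
From mathcomp Require Import ring lra zify.
Import Order.TTheory GRing.Theory Num.Theory.
Import numFieldNormedType.Exports.
Local Open Scope classical_set_scope.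
Local Open Scope ring_scope.

Set Implicit Arguments.
Unset Strict Implicit.
Unset Printing Implicit Defensive.

(** * Discrete Dirichlet Green function and the quadratic energy *)

Section Energy.
Variables (R : realFieldType) (N : nat).
Implicit Types (y p h : nat -> R) (k l : nat).

(** Covariance of a Brownian bridge of length [N] at integer times; it inverts minus the discrete
    Laplacian with zero values at [0] and [N]. *)
Definition green k l : R := (minn k l)%:R - k%:R * l%:R / N%:R.

Definition potential y k : R := \sum_(l < N.+1) green k l * y l.

Definition energy y : R :=
  \sum_(k < N.+1) y k * potential y k + 2 * N%:R * \sum_(k < N.+1) y k ^+ 2.

(** Half of the gradient of [energy], as [green] is symmetric. *)
Definition energy_gradient y k : R := potential y k + 2 * N%:R * y k.

Lemma greenC k l : green k l = green l k.
Proof. by rewrite /green minnC [k%:R * _]mulrC. Qed.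

Lemma green0 l : green 0 l = 0.
Proof. by rewrite /green min0n !mul0r subr0. Qed.

Hypothesis N_gt0 : (0 < N)%N.

Lemma greenN l : (l <= N)%N -> green N l = 0.
Proof.
move=> lN; have N0 : N%:R != 0 :> R by rewrite pnatr_eq0 -lt0n.
by rewrite /green (minn_idPr lN) mulrAC divff// mul1r subrr.
Qed.

Lemma green_ge0 k l : (k <= N)%N -> (l <= N)%N -> 0 <= green k l.
Proof.
wlog kl : k l / (k <= l)%N.
  by move=> W kN lN; case: (leqP k l) => [|/ltnW] ?; [|rewrite greenC]; exact: W.
move=> kN lN; rewrite /green (minn_idPl kl) subr_ge0 ler_pdivrMr ?ltr0n//.
by rewrite ler_wpM2l ?ler_nat.
Qed.

Lemma green_diag_le k : (k <= N)%N -> green k k <= N%:R.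
Proof.
move=> kN; rewrite /green minnn lerBlDr.
apply: (@le_trans _ _ N%:R); first by rewrite ler_nat.
by rewrite lerDl divr_ge0 ?mulr_ge0.
Qed.

(** The term [k l / N] is affine in [k] and drops out; the minimum changes slope only at [l], from 1
    to 0. *)
Lemma green_laplacian k l :
  2 * green k.+1 l - green k l - green k.+2 l = (k.+1 == l)%:R.
Proof.
have N0 : N%:R != 0 :> R by rewrite pnatr_eq0 -lt0n.
have -> : 2 * green k.+1 l - green k l - green k.+2 l =
    2 * (minn k.+1 l)%:R - (minn k l)%:R - (minn k.+2 l)%:R.
  by rewrite /green -[k.+2]addn2 -[k.+1]addn1 !natrD; field.
have E : ((minn k.+1 l).*2 = (k.+1 == l) + minn k l + minn k.+2 l)%N by lia.
have := congr1 (fun n => n%:R : R) E.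
by rewrite -muln2 !natrD natrM => E'; lra.
Qed.

Lemma potential0 y : potential y 0 = 0.
Proof. by rewrite /potential big1// => l _; rewrite green0 mul0r. Qed.

Lemma potentialN y : potential y N = 0.
Proof. by rewrite /potential big1// => l _; rewrite greenN ?mul0r// -ltnS. Qed.

Lemma sum_pick (F : nat -> R) k : (k <= N)%N ->
  \sum_(l < N.+1) (k == l)%:R * F l = F k.
Proof.
move=> kN; rewrite (bigD1 (Ordinal (kN : (k < N.+1)%N)))//= eqxx mul1r big1 ?addr0//.
move=> l; rewrite -val_eqE /= => /negbTE; rewrite eq_sym => ->; exact: mul0r.
Qed.

(** The last index [k.+1 = N] involves [potential y N.+1], outside the graph, where the closed form
    of [green] still obeys the recursion. *)
Lemma potential_laplacian y k : (k < N)%N ->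
  2 * potential y k.+1 - potential y k - potential y k.+2 = y k.+1.
Proof.
move=> kN; rewrite -[RHS](@sum_pick y k.+1)// /potential mulr_sumr -!sumrB.
by apply: eq_bigr => l _; rewrite -green_laplacian; ring.
Qed.

Lemma summation_by_parts y p n :
  \sum_(k < n) (y k.+1 - y k) * (p k.+1 - p k) =
  \sum_(k < n) y k.+1 * (2 * p k.+1 - p k - p k.+2)
    + y n * (p n.+1 - p n) - y 0%N * (p 1%N - p 0%N).
Proof.
elim: n => [|n IH]; first by rewrite !big_ord0; ring.
by rewrite !big_ord_recr /= IH; ring.
Qed.

Lemma dirichlet_form y p : y 0%N = 0 -> y N = 0 ->
  \sum_(k < N) (y k.+1 - y k) * (potential p k.+1 - potential p k) =
  \sum_(k < N.+1) y k * p k.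
Proof.
move=> y0 yN; rewrite summation_by_parts y0 yN !mul0r subr0 addr0.
rewrite big_ord_recl y0 mul0r add0r.
by apply: eq_bigr => k _; rewrite potential_laplacian.
Qed.

(** By [dirichlet_form] applied to [potential y], which vanishes at both ends, the first part of the
    energy is a sum of squares. *)
Lemma energy_ge y : 2 * N%:R * \sum_(k < N.+1) y k ^+ 2 <= energy y.
Proof.
rewrite /energy lerDr; under eq_bigr do rewrite mulrC.
rewrite -dirichlet_form ?potential0 ?potentialN//.
by apply: sumr_ge0 => k _; rewrite -expr2 sqr_ge0.
Qed.

Lemma energy_ge0 y : 0 <= energy y.
Proof.
by apply: le_trans (energy_ge y); rewrite !mulr_ge0// sumr_ge0// => k _; rewrite sqr_ge0.
Qed.

Lemma potentialD y h k :
  potential (fun l => y l + h l) k = potential y k + potential h k.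
Proof. by rewrite /potential -big_split /=; apply: eq_bigr => l _; rewrite mulrDr. Qed.

Lemma potential_sym y h :
  \sum_(k < N.+1) y k * potential h k = \sum_(k < N.+1) h k * potential y k.
Proof.
rewrite /potential; under eq_bigr do rewrite mulr_sumr.
rewrite exchange_big /=; apply: eq_bigr => l _; rewrite mulr_sumr.
by apply: eq_bigr => k _; rewrite greenC; ring.
Qed.

Lemma energyD y h : energy (fun l => y l + h l) =
  energy y + 2 * \sum_(k < N.+1) h k * energy_gradient y k + energy h.
Proof.
have -> : \sum_(k < N.+1) h k * energy_gradient y k =
    \sum_(k < N.+1) h k * potential y k + 2 * N%:R * \sum_(k < N.+1) y k * h k.
  by rewrite mulr_sumr -big_split /=; apply: eq_bigr => k _; rewrite /energy_gradient; ring.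
rewrite /energy; under eq_bigr do rewrite potentialD mulrDr !mulrDl.
rewrite !big_split /= (potential_sym y h); under [X in 2 * N%:R * X]eq_bigr do rewrite sqrrD.
by rewrite !big_split /=; ring.
Qed.

(** The energy is quadratic, so the increment is a linear term plus the energy of the perturbation.
    In the latter the cross term [- 2 a b green k k.+1] has a good sign, and the diagonal bound
    [green k k <= N] adds [N] to the coefficient [2 N] of the squares, whence [3 N]. *)
Lemma energy_step y k d a b : (k < N)%N -> 0 <= a -> 0 <= b ->
  energy (fun l => y l + d * (a * (k == l)%:R - b * (k.+1 == l)%:R)) - energy y <=
  2 * d * (a * energy_gradient y k - b * energy_gradient y k.+1)
    + 3 * N%:R * d ^+ 2 * (a ^+ 2 + b ^+ 2).
Proof.
move=> kN a0 b0; set h := fun l => d * (a * (k == l)%:R - b * (k.+1 == l)%:R).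
have sumh (F : nat -> R) : \sum_(l < N.+1) h l * F l = d * (a * F k - b * F k.+1).
  rewrite -(@sum_pick F k) ?(ltnW kN)// -(@sum_pick F k.+1)// !mulr_sumr -sumrB mulr_sumr.
  by apply: eq_bigr => l _; rewrite /h; ring.
rewrite (energyD y h) sumh.
have hk : h k = d * a by rewrite /h eqxx gtn_eqF//=; ring.
have hk1 : h k.+1 = - (d * b) by rewrite /h eqxx ltn_eqF//=; ring.
have poth l : potential h l = d * (a * green l k - b * green l k.+1).
  by rewrite -(sumh (green l)); apply: eq_bigr => i _; rewrite mulrC.
have -> : energy h = d ^+ 2 * (a ^+ 2 * green k k + b ^+ 2 * green k.+1 k.+1
    - 2 * (a * b * green k k.+1)) + 2 * N%:R * (d ^+ 2 * (a ^+ 2 + b ^+ 2)).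
  rewrite /energy; under [X in 2 * N%:R * X]eq_bigr do rewrite expr2.
  by rewrite !sumh hk hk1 !poth (greenC k.+1 k); ring.
have ab : 0 <= a * b * green k k.+1 by rewrite !mulr_ge0// green_ge0// ltnW.
have Ga : a ^+ 2 * green k k <= a ^+ 2 * N%:R.
  by rewrite ler_wpM2l ?sqr_ge0// green_diag_le// ltnW.
have Gb : b ^+ 2 * green k.+1 k.+1 <= b ^+ 2 * N%:R.
  by rewrite ler_wpM2l ?sqr_ge0// green_diag_le.
have : d ^+ 2 * (a ^+ 2 * green k k + b ^+ 2 * green k.+1 k.+1
    - 2 * (a * b * green k k.+1)) <= d ^+ 2 * (N%:R * (a ^+ 2 + b ^+ 2)).
  by rewrite ler_wpM2l ?sqr_ge0//; lra.
by lra.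
Qed.

(** With [d] the jump [y k.+1 - y k + D / N] and [p] the potential, the two terms [2 N d^2] cancel
    and each edge leaves [2 D d - d (p k.+1 - p k)]. The first part telescopes to [2 D^2];
    [dirichlet_form] turns the second into [- |y|^2]. *)
Lemma energy_drift y D : y 0%N = 0 -> y N = 0 ->
  \sum_(k < N) ((y k.+1 - y k + D / N%:R)
                * (energy_gradient y k - energy_gradient y k.+1)
                + 2 * N%:R * (y k.+1 - y k + D / N%:R) ^+ 2)
  = 2 * D ^+ 2 - \sum_(k < N.+1) y k ^+ 2.
Proof.
move=> y0 yN; have N0 : N%:R != 0 :> R by rewrite pnatr_eq0 -lt0n.
have tel (F : nat -> R) : \sum_(k < N) (F k.+1 - F k) = F N - F 0%N.
  by rewrite -(big_mkord xpredT (fun k => F k.+1 - F k)) telescope_sumr.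
under [X in _ - X]eq_bigr do rewrite expr2.
rewrite -(dirichlet_form y)//.
pose Z := energy_gradient y.
(* The added boundary differences are zero; once telescoped they supply the linear increments that
   make the identity hold edge by edge. *)
have -> : 2 * D ^+ 2 = \sum_(k < N) 2 * D ^+ 2 / N%:R + 2 * D * (y N - y 0%N) * 2
     - D / N%:R * (Z N - Z 0%N).
  rewrite sumr_const card_ord -mulr_natr /Z /energy_gradient potential0 potentialN y0 yN.
  by field.
rewrite -!tel !mulr_sumr mulr_suml -big_split -!sumrB /=.
by apply: eq_bigr => k _; rewrite /Z /energy_gradient; field.
Qed.

End Energy.

(** * Integrability of bounded functions and measurability of inverses *)

Section Bounded.
Context {d} {T : measurableType d} {R : realType}.

Lemma bounded_integrable (mu : {measure set T -> \bar R}) (A : set T)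
    (f : T -> R) (M : R) :
  measurable A -> (mu A < +oo)%E -> measurable_fun A f ->
  (forall x, `|f x| <= M) -> mu.-integrable A (EFin \o f).
Proof.
move=> mA Aoo mf fM; apply: measurable_bounded_integrable => //.
exists M; split; first exact: num_real.
by move=> y My x _; exact: le_trans (fM x) (ltW My).
Qed.

Lemma measurable_funV_ge (f : T -> R) (r : R) : 0 < r -> (forall x, r <= f x) ->
  measurable_fun setT f -> measurable_fun setT (fun x => (f x)^-1).
Proof.
move=> r0 rf mf; have -> : (fun x => (f x)^-1) = (fun y => y `^ (-1)) \o f.
  by apply/funext => x /=; rewrite powR_inv1// (le_trans (ltW r0)).
by apply: measurableT_comp => //; exact: measurable_powR.
Qed.

End Bounded.

(** * Integrals over the averaging parameter in the unit interval *)

Section UnitInterval.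
Context {R : realType}.
Notation leb := (@lebesgue_measure R).
Local Notation I01 := (`[0%R, 1%R]%classic : set R).

Lemma lebesgue_unit_itv : leb I01 = 1%E.
Proof. by rewrite lebesgue_measure_itv/= lte01 oppr0 adde0. Qed.

Lemma bounded_integrable01 (f : R -> R) (M : R) : measurable_fun setT f ->
  (forall x, `|f x| <= M) -> leb.-integrable I01 (EFin \o f).
Proof.
move=> mf fM.
have I01_fin : (leb I01 < +oo)%E by rewrite lebesgue_unit_itv ltry.
have mf01 : measurable_fun I01 f by exact: measurable_funTS.
by refine (@bounded_integrable _ _ R leb I01 f M _ I01_fin mf01 fM); exact: measurable_itv.
Qed.

Lemma onem_quadratic_integrable (A B C : R) :
  leb.-integrable I01 (EFin \o (fun v : R => A + B * (1 - v) + C * (1 - v) ^+ 2)).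
Proof.
apply: continuous_compact_integrable; first exact: segment_compact.
apply: continuous_subspaceT => x.
have cm : {for x, continuous (fun v : R => (1 - v))} by apply: cvgB; [exact: cvg_cst|].
apply: cvgD; last by apply: cvgM; [exact: cvg_cst|exact: cvgM].
by apply: cvgD; [exact: cvg_cst|apply: cvgM => //; exact: cvg_cst].
Qed.

Lemma Rintegral_onem_quadratic (A B C : R) :
  \int[leb]_(v in I01) (A + B * (1 - v) + C * (1 - v) ^+ 2) = A + B / 2 + C / 3.
Proof.
have If (f : R -> R) a b c : (forall v, f v = a + b * (1 - v) + c * (1 - v) ^+ 2) ->
    leb.-integrable I01 (EFin \o f).
  by move=> /funext ->; exact: onem_quadratic_integrable.
rewrite RintegralD//=; last 2 first.
- by apply: (If _ A B 0) => v; ring.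
- by apply: (If _ 0 0 C) => v; ring.
rewrite RintegralD//=; last 2 first.
- by apply: (If _ A 0 0) => v; ring.
- by apply: (If _ 0 B 0) => v; ring.
rewrite Rintegral_cst// [X in A * X](congr1 fine lebesgue_unit_itv) mulr1.
rewrite RintegralZl//; last by apply: (If _ 0 1 0) => v; ring.
rewrite RintegralZl//; last by apply: (If _ 0 0 1) => v; ring.
by rewrite -(Rintegral_onemXn 1) -(Rintegral_onemXn 2).
Qed.

(** Tonelli's theorem for nonnegative [g], after multiplication by the indicator of the unit
    interval. *)
Lemma measurable_Rintegral01 d (T : measurableType d) (g : T * R -> R) :
  measurable_fun setT g -> (forall p, 0 <= g p) ->
  measurable_fun setT (fun x => \int[leb]_(v in I01) g (x, v)).
Proof.
move=> mg g0.
pose h (p : T * R) : \bar R := (g p * \1_I01 p.2)%:E.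
have -> : (fun x => \int[leb]_(v in I01) g (x, v)) =
    fine \o (fun x => \int[leb]_v h (x, v))%E.
  apply/funext => x /=; rewrite /Rintegral [in LHS]integral_mkcond; congr fine.
  apply: eq_integral => v _; rewrite /h patchE indicE/=.
  by case: ifPn => _; rewrite ?mulr1 ?mulr0.
have mh : measurable_fun setT h.
  apply/measurable_EFinP; apply: measurable_funM => //.
  by apply: measurableT_comp => //; exact: measurable_indic.
have h0 p : (0 <= h p)%E by rewrite lee_fin mulr_ge0// indicE.
have mF : measurable_fun setT (fubini_F leb h).
  exact: measurable_fun_fubini_tonelli_F.
apply: (@measurableT_comp _ _ _ _ _ _ fine) => //.
Qed.

End UnitInterval.

(** * Deviation from the linear profile and its change under one averaging step *)

Section Deviation.
Context {R : realType}.
Variables (Tm Tp : R) (N : nat).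
Local Notation leb := (@lebesgue_measure R).
Local Notation I01 := (`[0%R, 1%R]%classic : set R).
Local Notation config := (N.+1.-tuple R).
Implicit Types (O : config) (v r : R) (k l : nat).

Definition profile k : R := Tm + k%:R / N%:R * (Tp - Tm).

(* Vanishes at the boundary by definition, so that the energy of [deviation O]
   is nonnegative for every configuration, not only those with the prescribed
   boundary values. *)
Definition deviation O k : R :=
  if (0 < k < N)%N then tnth O (inord k) - profile k else 0.

Definition boundary_ok O : Prop := tnth O ord0 = Tm /\ tnth O ord_max = Tp.

(* Edge [k] joins [k] and [k.+1]; only the first one is oriented downwards. *)
Definition opinion_edge k : nat * nat := if k is 0 then (1, 0)%N else (k, k.+1).

(* Averaging along edge [k] moves its left end by [left_weight] and its right end
   by [- right_weight] times the jump; a boundary end does not move. *)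
Definition left_weight k v : R := if k is 0 then 0 else 1 - v.

Definition right_weight k v : R :=
  if k is 0 then 1 - v else if k.+1 == N then 0 else v.

Definition opinion_jump O k : R := tnth O (inord k.+1) - tnth O (inord k).

Definition damped_energy r O : R := - (r + energy N (deviation O))^-1.

Lemma deviation0 O : deviation O 0 = 0. Proof. by []. Qed.

Lemma deviationN O : deviation O N = 0.
Proof. by rewrite /deviation ltnn andbF. Qed.

Lemma opinion_edgesE : (0 < N)%N ->
  opinion_edges N = [seq opinion_edge k | k <- iota 0 N].
Proof.
case: N => // n _; rewrite /opinion_edges subSS subn0 /=; congr cons.
by apply/eq_in_map => k; rewrite mem_iota; case: k.
Qed.

Lemma opinion_generatorE (f : config -> R) O : (0 < N)%N ->
  opinion_generator f O =
  \sum_(k < N) \int[leb]_(v in I01)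
     (f (opinion_update (opinion_edge k).1 (opinion_edge k).2 v O) - f O).
Proof.
move=> N0; rewrite /opinion_generator opinion_edgesE// big_map.
by rewrite -[in iota 0 _](subn0 N) big_mkord.
Qed.

Hypothesis N_gt1 : (1 < N)%N.
Let N_gt0 : (0 < N)%N. Proof. exact: ltnW. Qed.
Let N_neq0 : N%:R != 0 :> R. Proof. by rewrite pnatr_eq0 -lt0n. Qed.

Lemma deviationE O k : boundary_ok O -> (k <= N)%N ->
  tnth O (inord k) = deviation O k + profile k.
Proof.
move=> bO kN; have [eq0 eqN] := bO; rewrite /deviation; case: ifPn => [_|]; first by rewrite subrK.
rewrite negb_and -leqNgt leqn0 -leqNgt => /orP[/eqP->|Nk].
  by rewrite (_ : inord 0 = ord0) ?eq0 /profile; [ring|apply/val_inj; rewrite /= inordK].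
have -> : k = N by apply/eqP; rewrite eqn_leq kN.
rewrite (_ : inord N = ord_max) ?eqN /profile ?divff//; first by ring.
by apply/val_inj; rewrite /= inordK.
Qed.

Lemma opinion_jumpE O k : boundary_ok O -> (k < N)%N ->
  opinion_jump O k = deviation O k.+1 - deviation O k + (Tp - Tm) / N%:R.
Proof.
move=> bO kN; rewrite /opinion_jump !deviationE// 1?ltnW//.
by rewrite /profile -[k.+1]addn1 natrD; field.
Qed.

(** Averaging puts both ends at the fraction [1 - v] of the way from left to right, which moves them
    by [1 - v] and [- v] times the jump. On edge [0] the orientation is reversed, so that [v] weighs
    the right end. *)
Lemma deviation_update O k v : (k < N)%N ->
  deviation (opinion_update (opinion_edge k).1 (opinion_edge k).2 v O) =
  fun l => deviation O l + opinion_jump O k *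
    (left_weight k v * (k == l)%:R - right_weight k v * (k.+1 == l)%:R).
Proof.
move=> kN; apply/funext => l; rewrite /deviation.
case: ifPn => [/andP[l0 lN]|]; last first.
  rewrite negb_and -leqNgt leqn0 -leqNgt => /orP[/eqP->|Nl].
    by case: (k) => [|k'] /=; ring.
  rewrite (ltn_eqF (leq_trans kN Nl)); case: eqVneq => [kl|_] /=; last by ring.
  (* Here [l = k.+1 = N]; the case [k = 0] is excluded by [1 < N]. *)
  have -> : right_weight k v = 0.
    by rewrite /right_weight; case: k kN kl => [|k] *; [lia|rewrite ifT//; lia].
  by ring.
have lN1 : (l < N.+1)%N by exact: ltnW.
rewrite tnth_mktuple /= inordK// l0 lN andbT /opinion_jump.
case: k kN => [|k] kN /=.
  case: (eqVneq l 1%N) => [->|l1] /=; first by ring.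
  have /negbTE -> : l != 0%N by rewrite -lt0n.
  rewrite ltn_eqF//=; ring.
rewrite (eq_sym k.+1 l) (eq_sym k.+2 l).
case: (eqVneq l k.+1) => [El|l1] /=.
  by rewrite El [k.+1 == k.+2]ltn_eqF//=; ring.
case: (eqVneq l k.+2) => [El|l2] /=; last by ring.
by rewrite -El ltn_eqF//=; ring.
Qed.

Lemma measurable_deviation k : measurable_fun setT (deviation^~ k).
Proof.
rewrite /deviation; case: (0 < k < N)%N; last exact: measurable_cst.
by apply: measurable_funB => //; exact: measurable_tnth.
Qed.

Lemma measurable_energy : measurable_fun setT (energy N \o deviation).
Proof.
have mD := measurable_deviation.
apply: measurable_funD.
  apply: measurable_sum => k; apply: measurable_funM => //.
  by apply: measurable_sum => l; apply: measurable_funM.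
by apply: measurable_funM => //; apply: measurable_sum => k; exact: measurable_funX.
Qed.

Lemma measurable_damped_energy r : 0 < r -> measurable_fun setT (damped_energy r).
Proof.
move=> r0; apply: measurableT_comp => //; apply: (measurable_funV_ge r0).
  by move=> O; rewrite lerDl energy_ge0.
by apply: measurable_funD => //; exact: measurable_energy.
Qed.

Lemma damped_energy_bound r O : 0 < r -> - r^-1 <= damped_energy r O <= 0.
Proof.
move=> r0; have E0 := energy_ge0 N_gt0 (deviation O).
have rE0 : 0 < r + energy N (deviation O) by rewrite ltr_wpDr.
by rewrite /damped_energy oppr_le0 invr_ge0 (ltW rE0) andbT lerN2 lef_pV2 ?posrE// lerDl.
Qed.

Lemma measurable_opinion_update i j :
  measurable_fun setT (fun p : config * R => opinion_update i j p.2 p.1).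
Proof.
apply/measurable_fun_tnthP => l; rewrite /comp.
under eq_fun do rewrite tnth_mktuple.
have mt m : measurable_fun setT (fun p : config * R => tnth p.1 m).
  by apply: (measurableT_comp (f := fun O : config => tnth O m)) => //;
    exact: measurable_tnth.
case: (((val l == i) || (val l == j)) && (0 < val l < N)%N); last exact: mt.
apply: measurable_funD; apply: measurable_funM => //.
by apply: measurable_funB.
Qed.

End Deviation.

(** * Drift of the damped energy under the generator *)

Section Drift.
Context {R : realType}.
Variables (Tm Tp : R) (N : nat).
Hypothesis N_gt1 : (1 < N)%N.
Local Notation leb := (@lebesgue_measure R).
Local Notation I01 := (`[0%R, 1%R]%classic : set R).
Local Notation config := (N.+1.-tuple R).
Local Notation Y := (@deviation R Tm Tp N).
Local Notation Q O := (energy_gradient N (Y O)).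
Local Notation F r := (damped_energy Tm Tp r).
Local Notation jump := (@opinion_jump R N).
Local Notation edge_update k v O :=
  (opinion_update (opinion_edge k).1 (opinion_edge k).2 v O).
Implicit Types (O : config) (v r : R) (k l : nat).

Let N_gt0 : (0 < N)%N. Proof. exact: ltnW. Qed.

(* Concavity of [x |-> - 1 / (r + x)]. *)
Lemma damped_energy_increment r O1 O2 : 0 < r ->
  F r O1 - F r O2 <=
  (energy N (Y O1) - energy N (Y O2)) / (r + energy N (Y O2)) ^+ 2.
Proof.
move=> r0; have E1 := energy_ge0 N_gt0 (Y O1); have E2 := energy_ge0 N_gt0 (Y O2).
rewrite /damped_energy; set s := r + energy N (Y O1); set t := r + energy N (Y O2).
have s0 : 0 < s by rewrite ltr_wpDr.
have t0 : 0 < t by rewrite ltr_wpDr.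
have -> : energy N (Y O1) - energy N (Y O2) = s - t by rewrite /s /t; ring.
rewrite -subr_ge0.
have -> : (s - t) / t ^+ 2 - (- s^-1 - - t^-1) = (s - t) ^+ 2 / (t ^+ 2 * s).
  by field; rewrite !lt0r_neq0.
by rewrite divr_ge0 ?sqr_ge0// mulr_ge0 ?sqr_ge0// ltW.
Qed.

Lemma measurable_damped_edge r k : 0 < r -> measurable_fun setT
  (fun p : config * R => F r (edge_update k p.2 p.1)).
Proof.
move=> r0; apply: (measurableT_comp (f := F r)).
  exact: measurable_damped_energy.
exact: measurable_opinion_update.
Qed.

Lemma damped_edge_integrable r k O : 0 < r ->
  leb.-integrable I01 (EFin \o (fun v => F r (edge_update k v O) - F r O)).
Proof.
move=> r0; apply: (@bounded_integrable01 _ _ r^-1).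
  apply: measurable_funB => //.
  exact: (measurableT_comp (measurable_damped_edge k r0) (pair1_measurable O)).
move=> v; have /andP[] := damped_energy_bound Tm Tp N_gt1 O r0.
have /andP[] := damped_energy_bound Tm Tp N_gt1 (edge_update k v O) r0.
by rewrite ler_norml; lra.
Qed.

(* Over [v] in [0, 1] the weights average to 1/2 and their squares to 1/3, except
   for the zero boundary weights; these do no harm, since the energy gradient
   vanishes at the boundary. *)
Lemma edge_weights_quadratic k (q1 q2 d : R) : (k < N)%N ->
  (k = 0%N -> q1 = 0) -> (k.+1 = N -> q2 = 0) ->
  exists A B C : R,
    (forall v, 2 * d * (left_weight k v * q1 - right_weight N k v * q2)
       + 3 * N%:R * d ^+ 2 * (left_weight k v ^+ 2 + right_weight N k v ^+ 2)
       = A + B * (1 - v) + C * (1 - v) ^+ 2) /\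
    A + B / 2 + C / 3 <= d * (q1 - q2) + 2 * N%:R * d ^+ 2.
Proof.
move=> kN q10 q20.
have Nd0 : 0 <= N%:R * d ^+ 2 by rewrite mulr_ge0// sqr_ge0.
case: k kN q10 q20 => [|k] kN q10 q20 /=.
  exists 0, (- 2 * d * q2), (3 * N%:R * d ^+ 2); split; first by move=> v; ring.
  by rewrite q10//; lra.
case: eqVneq q20 => [kN1 /(_ kN1) ->|_ _].
  exists 0, (2 * d * q1), (3 * N%:R * d ^+ 2); split; first by move=> v; ring.
  by lra.
(* Expansion in powers of [1 - v]. On an interior edge the bound is an equality: the averages 1/3 of
   the two squares turn [3 N] into [2 N]. *)
exists (- 2 * d * q2 + 3 * N%:R * d ^+ 2),
  (2 * d * (q1 + q2) - 6 * N%:R * d ^+ 2), (6 * N%:R * d ^+ 2).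
by split=> [v|]; [ring|lra].
Qed.

(** For each [v], concavity reduces the increment to that of the energy, with slope taken at [O],
    and [energy_step] bounds the latter by a quadratic in [1 - v], which is then integrated. *)
Lemma edge_drift r k O : 0 < r -> (k < N)%N ->
  \int[leb]_(v in I01) (F r (edge_update k v O) - F r O) <=
  (jump O k * (Q O k - Q O k.+1) + 2 * N%:R * jump O k ^+ 2)
    / (r + energy N (Y O)) ^+ 2.
Proof.
move=> r0 kN; set t := r + energy N (Y O).
have t20 : 0 <= (t ^+ 2)^-1 by rewrite invr_ge0 sqr_ge0.
have [A [B [C [ABC le_ABC]]]] : exists A B C : R,
    (forall v, 2 * jump O k * (left_weight k v * Q O k - right_weight N k v * Q O k.+1)
       + 3 * N%:R * jump O k ^+ 2 * (left_weight k v ^+ 2 + right_weight N k v ^+ 2)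
       = A + B * (1 - v) + C * (1 - v) ^+ 2) /\
    A + B / 2 + C / 3 <= jump O k * (Q O k - Q O k.+1) + 2 * N%:R * jump O k ^+ 2.
  apply: edge_weights_quadratic => //.
    by move=> ->; rewrite /energy_gradient potential0 deviation0; ring.
  by move=> ->; rewrite /energy_gradient potentialN// deviationN; ring.
apply: (@le_trans _ _ ((A + B / 2 + C / 3) / t ^+ 2)); last by rewrite ler_wpM2r.
rewrite -Rintegral_onem_quadratic -RintegralZr//; last exact: onem_quadratic_integrable.
apply: le_Rintegral => //.
- exact: damped_edge_integrable.
- have -> : (fun v => (A + B * (1 - v) + C * (1 - v) ^+ 2) / t ^+ 2) =
    (fun v => A / t ^+ 2 + B / t ^+ 2 * (1 - v) + C / t ^+ 2 * (1 - v) ^+ 2).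
    by apply/funext => v; ring.
  exact: onem_quadratic_integrable.
move=> v /=; rewrite in_itv /= => /andP[v0 v1].
apply: le_trans (damped_energy_increment _ _ r0) _; rewrite ler_wpM2r// -ABC.
rewrite deviation_update//; apply: energy_step => //.
  by case: (k) => [//|k'] /=; rewrite subr_ge0.
by case: (k) => [|k'] /=; [rewrite subr_ge0|case: ifP].
Qed.

(** The prescribed boundary values turn every jump into an increment of the deviation plus
    [(Tp - Tm) / N], the form summed in [energy_drift]. *)
Lemma generator_drift r O : 0 < r -> boundary_ok Tm Tp O ->
  opinion_generator (F r) O <=
  (2 * (Tp - Tm) ^+ 2 - \sum_(k < N.+1) Y O k ^+ 2) / (r + energy N (Y O)) ^+ 2.
Proof.
move=> r0 bO; rewrite opinion_generatorE//.
rewrite -(energy_drift (N := N) N_gt0 (Tp - Tm))//; last exact: deviationN.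
rewrite mulr_suml; apply: ler_sum => k _.
by rewrite -opinion_jumpE// edge_drift.
Qed.

Lemma measurable_damped_generator r : 0 < r ->
  measurable_fun setT (opinion_generator (F r) : config -> R).
Proof.
(* Adding [r^-1] makes the integrand nonnegative, as required by [measurable_Rintegral01]. *)
move=> r0; have -> : opinion_generator (F r) = fun O : config =>
    \sum_(k < N) (\int[leb]_(v in I01)
       (F r (edge_update k v O) - F r O + r^-1) - r^-1).
  apply/funext => O; rewrite opinion_generatorE//; apply: eq_bigr => k _.
  have Ic : leb.-integrable I01 (EFin \o cst r^-1).
    by apply: (@bounded_integrable01 _ _ `|r^-1|).
  rewrite [in RHS]RintegralD//; last exact: damped_edge_integrable.
  by rewrite [in RHS]Rintegral_cst// [X in r^-1 * X](congr1 fine lebesgue_unit_itv) mulr1 addrK.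
apply: measurable_sum => k; apply: measurable_funB => //.
apply: (measurable_Rintegral01
  (g := fun p : config * R => F r (edge_update k p.2 p.1) - F r p.1 + r^-1)).
  apply: measurable_funD => //; apply: measurable_funB.
    exact: measurable_damped_edge.
  by apply: (measurableT_comp (f := F r)) => //; exact: measurable_damped_energy.
move=> p; have /andP[] := damped_energy_bound Tm Tp N_gt1 p.1 r0.
have /andP[] := damped_energy_bound Tm Tp N_gt1 (edge_update k p.2 p.1) r0.
by lra.
Qed.

(** Each of the [N] edges contributes at most the oscillation [r^-1] of the damped energy. This
    gives integrability, and control at configurations with other boundary values. *)
Lemma damped_generator_bound r O : 0 < r -> `|opinion_generator (F r) O| <= N%:R * r^-1.
Proof.
move=> r0; rewrite opinion_generatorE//.
apply: le_trans (ler_norm_sum _ _ _) _.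
rewrite mulr_natl -[X in _ *+ X]card_ord -sumr_const; apply: ler_sum => k _.
have Ic : leb.-integrable I01 (EFin \o cst r^-1).
  by apply: (@bounded_integrable01 _ _ `|r^-1|).
apply: le_trans (le_normr_Rintegral _ _) _ => //; first exact: damped_edge_integrable.
rewrite -[leRHS]mulr1 -[X in r^-1 * X](congr1 fine lebesgue_unit_itv) -Rintegral_cst//.
apply: le_Rintegral => //.
  exact: (integrable_norm (damped_edge_integrable k O r0)).
move=> v _ /=; have /andP[] := damped_energy_bound Tm Tp N_gt1 O r0.
have /andP[] := damped_energy_bound Tm Tp N_gt1 (edge_update k v O) r0.
by rewrite ler_norml; lra.
Qed.

End Drift.

(** * Weak-type bound for the squared deviation under an invariant measure *)

Section Tail.
Context {R : realType}.
Variables (Tm Tp : R) (N : nat).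
Hypothesis N_gt1 : (1 < N)%N.
Local Notation config := (N.+1.-tuple R).
Local Notation Y := (@deviation R Tm Tp N).
Local Notation F r := (damped_energy Tm Tp r).
Local Notation sqY := (fun O : config => \sum_(k < N.+1) Y O k ^+ 2).
Variable nu : probability config R.
Hypothesis nu_invariant : opinion_invariant Tm Tp nu.

Let N_gt0 : (0 < N)%N. Proof. exact: ltnW. Qed.

Lemma probability_bounded_integrable (f : config -> R) (M : R) :
  measurable_fun setT f -> (forall O, `|f O| <= M) ->
  nu.-integrable setT (EFin \o f).
Proof.
move=> mf fM; have nuT : (nu setT < +oo)%E by rewrite probability_setT ltry.
exact: (bounded_integrable measurableT nuT mf fM).
Qed.

Lemma indic_integrable (A : set config) (c : R) : measurable A ->
  nu.-integrable setT (EFin \o (fun O => c * \1_A O)).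
Proof.
move=> mA; apply: (@probability_bounded_integrable _ `|c|).
  by apply: measurable_funM => //; exact: measurable_indic.
by move=> O; rewrite normrM indicE ler_piMr// ger0_norm// lern1 leq_b1.
Qed.

Lemma Rintegral_scale_indic (A : set config) (c : R) : measurable A ->
  \int[nu]_O (c * \1_A O) = c * fine (nu A).
Proof.
move=> mA; have I1 := indic_integrable 1 mA.
rewrite RintegralZl//; last by move: I1; under eq_fun do rewrite mul1r.
by rewrite /Rintegral integral_indic// setIT.
Qed.

Lemma measurable_eq_tnth k (x : R) : measurable [set O : config | tnth O k = x].
Proof.
have -> : [set O : config | tnth O k = x] = (fun O : config => tnth O k) @^-1` [set x].
  by [].
by rewrite -[_ @^-1` _]setTI; apply: measurable_tnth.
Qed.

Lemma measurable_boundary_ok : measurable [set O : config | boundary_ok Tm Tp O].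
Proof. by apply: measurableI; exact: measurable_eq_tnth. Qed.

Lemma boundary_null : nu (~` [set O | boundary_ok Tm Tp O]) = 0%E.
Proof.
have [+ _] := nu_invariant; set S := [set O | _] => nuS.
have mS : measurable S.
  have -> : S = [set O : config | boundary_ok Tm Tp O] `&`
      \bigcap_(k in [set: 'I_N.+1]) [set O : config | 0 <= tnth O k].
    apply/seteqP; split=> O /=; first by move=> [? [? P]]; split=> // k _; exact: P.
    by move=> [[? ?] P]; split=> //; split=> // k; exact: P.
  apply: measurableI; first exact: measurable_boundary_ok.
  apply: fin_bigcap_measurable => // k _.
  have -> : [set O : config | 0 <= tnth O k] = (fun O : config => tnth O k) @^-1` `[0, +oo[.
    by apply/seteqP; split=> O /=; rewrite in_itv/= andbT.
  by rewrite -[_ @^-1` _]setTI; apply: measurable_tnth.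
apply/eqP; rewrite eq_le measure_ge0 andbT.
have <- : nu (~` S) = 0%E by rewrite probability_setC// [X in (1 - X)%E]nuS subee.
apply: le_measure; rewrite ?inE; [|exact: measurableC|].
  by apply: measurableC; exact: measurable_boundary_ok.
by apply: subsetC => O [? [? ?]].
Qed.

Lemma measurable_sqY : measurable_fun setT sqY.
Proof.
by apply: measurable_sum => k; apply: measurable_funX; exact: measurable_deviation.
Qed.

Definition tail_set (t r : R) : set config :=
  [set O | t < sqY O /\ energy N (Y O) <= r].

Lemma measurable_tail_set t r : measurable (tail_set t r).
Proof.
have -> : tail_set t r = (sqY @^-1` `]t, +oo[) `&` ((energy N \o Y) @^-1` `]-oo, r]).
  by apply/seteqP; split=> O /=; rewrite !in_itv/= andbT.
apply: measurableI; rewrite -[_ @^-1` _]setTI.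
  by apply: measurable_sqY.
by apply: measurable_energy.
Qed.

(* On the tail set [t / (4 r^2) <= |Y|^2 / (r + F)^2], as [F <= r]; configurations
   with other boundary values enter through the indicator of a null set. *)
Lemma truncated_tail t r : 0 < t -> 0 < r ->
  (nu (tail_set t r) <= (8 * (Tp - Tm) ^+ 2 / t)%:E)%E.
Proof.
move=> t0 r0; have mA := measurable_tail_set t r.
have mB := measurableC measurable_boundary_ok.
set A := tail_set t r in mA *; set B := ~` _ in mB.
(* [a] bounds the positive part of the drift, since the energy is nonnegative; [b] is the
   dissipation guaranteed on the tail set. Their ratio does not depend on [r]. *)
pose a := 2 * (Tp - Tm) ^+ 2 / r ^+ 2; pose b := t / (4 * r ^+ 2).
(* On [B] this dominates the crude generator bound and compensates [- b] on [A]. *)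
pose K := N%:R * r^-1 + b.
have b0 : 0 < b by rewrite divr_gt0// mulr_gt0// exprn_gt0.
have a0 : 0 <= a by rewrite divr_ge0 ?sqr_ge0// mulr_ge0// sqr_ge0.
have gen_le O : opinion_generator (F r) O <= a + - b * \1_A O + K * \1_B O.
  have [bO|bO] := pselect (boundary_ok Tm Tp O); last first.
    have -> : \1_B O = 1 :> R by rewrite indicE mem_set.
    have /ler_normlP[_ gN] := damped_generator_bound Tm Tp N_gt1 O r0.
    have : b * \1_A O <= b by rewrite ler_piMr ?(ltW b0)// indicE lern1 leq_b1.
    by rewrite /K; lra.
  have -> : \1_B O = 0 :> R by rewrite indicE memNset// => /(_ bO).
  rewrite mulr0 addr0; apply: le_trans (generator_drift N_gt1 r0 bO) _.
  have E0 := energy_ge0 N_gt0 (Y O); have s0 : 0 <= sqY O.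
    by apply: sumr_ge0 => k _; rewrite sqr_ge0.
  have rE : 0 < r + energy N (Y O) by rewrite ltr_wpDr.
  rewrite mulrBl lerD//.
    apply: ler_wpM2l; first by rewrite mulr_ge0 ?sqr_ge0.
    rewrite lef_pV2 ?posrE ?exprn_gt0//.
    by rewrite lerXn2r ?nnegrE ?(ltW rE) ?(ltW r0)// lerDl.
  rewrite mulNr lerN2 indicE; case: (boolP (O \in A)) => [|_]; last first.
    by rewrite mulr0 divr_ge0// sqr_ge0.
  rewrite inE => -[tY Er]; rewrite mulr1 /b.
  apply: ler_pM; rewrite ?invr_ge0 ?mulr_ge0 ?sqr_ge0 ?(ltW t0) ?(ltW r0)//.
    exact: ltW.
  rewrite lef_pV2 ?posrE ?mulr_gt0 ?exprn_gt0//.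
  have -> : 4 * r ^+ 2 = (r + r) ^+ 2 by ring.
  have rr0 : 0 <= r + r by rewrite addr_ge0 ?ltW.
  by rewrite ler_pXn2r ?nnegrE ?(ltW rE)// lerD2l.
have mF := measurable_damped_energy Tm Tp N_gt1 r0.
have iF : nu.-integrable setT (EFin \o (opinion_generator (F r) : config -> R)).
  apply: (@probability_bounded_integrable _ (N%:R * r^-1)).
    exact: measurable_damped_generator.
  by move=> O; exact: damped_generator_bound.
have ia : nu.-integrable setT (EFin \o (fun=> a)).
  exact: (@probability_bounded_integrable _ `|a|).
have iA := indic_integrable (- b) mA; have iB := indic_integrable K mB.
have iaA : nu.-integrable setT (EFin \o (fun O => a + - b * \1_A O)).
  exact: (integrableD measurableT ia iA).
have [_ /(_ (F r) mF) inv] := nu_invariant.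
have {}inv : Rintegral nu setT (opinion_generator (F r)) = 0.
  apply: inv; exists r^-1 => O; have := damped_energy_bound Tm Tp N_gt1 O r0.
  have rV0 : 0 < r^-1 by rewrite invr_gt0.
  by rewrite ler_norml; lra.
have : 0 <= a - b * fine (nu A).
  rewrite -inv; apply: le_trans (le_Rintegral measurableT iF
    (integrableD measurableT iaA iB) (fun O _ => gen_le O)) _.
  rewrite RintegralD//= RintegralD//= !Rintegral_scale_indic// Rintegral_cst//.
  rewrite [X in a * X](congr1 fine (probability_setT nu)) [X in K * X](congr1 fine boundary_null).
  by rewrite mulr0 addr0 mulr1 mulNr.
have -> : 8 * (Tp - Tm) ^+ 2 / t = a / b by rewrite /a /b; field; rewrite !lt0r_neq0.
rewrite subr_ge0 mulrC -ler_pdivlMr// => H.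
rewrite -[nu A]fineK ?lee_fin//.
exact: fin_num_measure.
Qed.

(** The truncated bound is uniform in [r], so continuity from below along integer [r] removes the
    energy cutoff. *)
Lemma deviation_tail (t : R) : 0 < t ->
  (nu [set O : config | (t < sqY O)%R] <= (8 * (Tp - Tm) ^+ 2 / t)%:E)%E.
Proof.
move=> t0; have E : [set O : config | t < sqY O] = \bigcup_n tail_set t n.+1%:R.
  apply/seteqP; split=> O /=; last by move=> [n _ []].
  move=> tO; exists (Num.truncn (energy N (Y O))) => //; split=> //.
  by rewrite ltW// truncnS_gt.
have mT n : measurable (tail_set t n.+1%:R) by exact: measurable_tail_set.
have cv : nu \o (fun n => tail_set t n.+1%:R) @ \oo --> nu [set O : config | (t < sqY O)%R].
  rewrite E; apply: nondecreasing_cvg_mu => //; first exact: bigcup_measurable.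
  move=> m n mn; apply/subsetPset => O [tO Em]; split=> //.
  by apply: le_trans Em _; rewrite ler_nat.
rewrite -(cvg_lim _ cv)//; apply: lime_le; first by apply/cvg_ex; eexists; exact: cv.
by apply: nearW => n; exact: truncated_tail.
Qed.

End Tail.

(** * Uniform continuity and convergence of Riemann sums *)

Section RiemannSum.
Context {R : realType}.
Notation leb := (@lebesgue_measure R).
Implicit Types (a b e : R) (f : R -> R).

Lemma segment_uniform_continuity a b f : {within `[a, b], continuous f} ->
  forall e, 0 < e -> exists2 dl, 0 < dl & forall x y,
    x \in `[a, b] -> y \in `[a, b] -> `|x - y| < dl -> `|f x - f y| < e.
Proof.
move=> cf e e0.
(* Compactness in near-covering form, with the modulus [dl] tending to 0 from the right: local
   moduli merge into a global one. *)
have := proj1 (compact_near_coveringP _) (@segment_compact R a b).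
move=> /(_ R (0^'+ : set_system R) (fun dl x => x \in `[a, b] -> forall y,
  y \in `[a, b] -> `|x - y| < dl -> `|f x - f y| < e) _) [].
  move=> x xab; have /subspace_continuousP /(_ x xab) := cf.
  move=> /cvgrPdist_lt /(_ (e / 2) (divr_gt0 e0 (ltr0n _ 2))).
  rewrite /nbhs /= /within /= => /nbhs_ballP [d /= d0 dP].
  have d20 : 0 < d / 2 by rewrite divr_gt0.
  (* Halving keeps both [x'] and [y] within [d] of the centre [x]. *)
  exists ([set x' | `|x - x'| < d / 2], [set i | i < d / 2]) => /=.
    split; first by apply/nbhs_ballP; exists (d / 2).
    exact: nbhs_right_lt.
  move=> [x' i] /= [xx' id] x'ab y yab x'y.
  have H z : `|x - z| < d -> z \in `[a, b] -> `|f x - f z| < e / 2 by exact: dP.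
  have Hx' : `|f x - f x'| < e / 2 by apply: H => //; lra.
  have Hy : `|f x - f y| < e / 2.
    apply: H => //; have := ler_distD x' x y; lra.
  by have := ler_distD (f x) (f x') (f y); rewrite (distrC (f x') (f x)); lra.
move=> dl /= dl0 dlP; exists (dl / 2); first by rewrite divr_gt0.
move=> x y xab yab xy; apply: (dlP (dl / 2)) => //=.
- by rewrite sub0r normrN gtr0_norm ?divr_gt0//; lra.
- by rewrite divr_gt0.
Qed.

Lemma Rintegral_cst_itv a b (c : R) : a <= b ->
  \int[leb]_(x in `[a, b]) c = c * (b - a).
Proof.
move=> ab; rewrite Rintegral_cst// [X in c * X](_ : _ = b - a)//.
have : leb `[a, b]%classic = (b - a)%:E.
  rewrite lebesgue_measure_itv/= lte_fin; case: ltgtP ab => // -> _.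
  by rewrite subrr.
by move=> /(congr1 fine).
Qed.

Lemma Rintegral_itv_approx a b f (c e : R) : a <= b ->
  {within `[a, b], continuous f} -> (forall x, x \in `[a, b] -> `|f x - c| <= e) ->
  `|\int[leb]_(x in `[a, b]) f x - c * (b - a)| <= e * (b - a).
Proof.
move=> ab cf fc; have icst d : leb.-integrable `[a, b] (EFin \o (fun=> d : R)).
  by apply: continuous_compact_integrable; [exact: segment_compact|
    apply: continuous_subspaceT => x; exact: cvg_cst].
have If : leb.-integrable `[a, b] (EFin \o f).
  by apply: continuous_compact_integrable => //; exact: segment_compact.
have Ifc : leb.-integrable `[a, b] (EFin \o (fun x => f x - c)).
  have := integrableB _ If (icst c); exact.
rewrite -!Rintegral_cst_itv// -RintegralB//.
apply: le_trans (le_normr_Rintegral _ _) _ => //.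
apply: le_Rintegral => //; exact: (integrable_norm Ifc).
Qed.

Lemma riemann_sum_approx f (N : nat) (e : R) : (0 < N)%N ->
  {within `[0, 1], continuous f} ->
  (forall x y, x \in `[0, 1] -> y \in `[0, 1] -> `|x - y| <= N%:R^-1 -> `|f x - f y| <= e) ->
  `|\int[leb]_(x in `[0, 1]) f x - N%:R^-1 * \sum_(k < N) f (k%:R / N%:R)| <= e.
Proof.
move=> N0 cf fe; have Nr0 : 0 < N%:R :> R by rewrite ltr0n.
have NV0 : 0 < N%:R^-1 :> R by rewrite invr_gt0.
(* Induction over the cells of the left-endpoint rule: the error on each is at most [e] times its
   length, and these add up. *)
suff H n : (n <= N)%N ->
    `|\int[leb]_(x in `[0, n%:R / N%:R]) f x
      - N%:R^-1 * \sum_(k < n) f (k%:R / N%:R)| <= e * (n%:R / N%:R).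
  by have := H N (leqnn N); rewrite divff ?lt0r_neq0// mulr1.
elim: n => [_|n IH nN].
  by rewrite mul0r set_itv1 Rintegral_set1 big_ord0 !mulr0 subrr normr0.
pose p : R := n%:R / N%:R; pose q : R := n.+1%:R / N%:R.
have pq : q - p = N%:R^-1.
  by rewrite /p /q -[n.+1]addn1 natrD; field; rewrite lt0r_neq0.
have p0 : 0 <= p by rewrite divr_ge0.
have q1 : q <= 1 by rewrite ler_pdivrMr// mul1r ler_nat.
have pq' : p <= q by lra.
have sub01 a b : 0 <= a -> b <= 1 -> {within `[a, b], continuous f}.
  by move=> a0 b1; apply: continuous_subspaceW cf; apply: subset_itvScc.
have int_f : leb.-integrable `[0, q] (EFin \o f).
  apply: continuous_compact_integrable; first exact: segment_compact.
  exact: sub01.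
have split_int : \int[leb]_(x in `[0, q]) f x =
    \int[leb]_(x in `[0, p]) f x + \int[leb]_(x in `[p, q]) f x.
  rewrite -(@Rintegral_itv_obnd_cbnd _ p); last first.
    by apply: integrableS int_f => //; apply: subset_itvr; rewrite bnd_simp.
  rewrite -(@Rintegral_itvB _ f (BLeft 0) (BRight q) p int_f) ?bnd_simp//.
  by rewrite addrC subrK.
have piece : `|\int[leb]_(x in `[p, q]) f x - f p * (q - p)| <= e * (q - p).
  apply: Rintegral_itv_approx => //; first exact: sub01.
  move=> x; rewrite in_itv/= => /andP[px xq].
  apply: fe; rewrite ?in_itv/=; [apply/andP; split; lra|apply/andP; split; lra|].
  by rewrite ger0_norm; lra.
rewrite -/q split_int big_ord_recr /= -/p.
have /IH : (n <= N)%N by exact: ltnW.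
rewrite -/p; set I := Rintegral _ _ _; set J := Rintegral _ _ _; set S := \sum_(k < n) _.
move=> IHn; rewrite mulrDr.
have -> : I + J - (N%:R^-1 * S + N%:R^-1 * f p) =
  (I - N%:R^-1 * S) + (J - f p * (q - p)) by rewrite pq; ring.
apply: le_trans (ler_normD _ _) _.
have -> : e * q = e * p + e * (q - p) by ring.
exact: lerD.
Qed.

Lemma riemann_sum_cvg f : {within `[0, 1], continuous f} -> forall e, 0 < e ->
  \forall N \near \oo, `|N%:R^-1 * \sum_(k < N.+1) f (k%:R / N%:R)
     - \int[leb]_(x in `[0, 1]) f x| < e.
Proof.
move=> cf e e0; have e40 : 0 < e / 4 by rewrite divr_gt0.
have [dl dl0 dlP] := segment_uniform_continuity cf e40.
near=> N.
have N0 : (0 < N)%N by near: N; exact: nbhs_infty_gt.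
have Nr0 : 0 < N%:R :> R by rewrite ltr0n.
have Ndl : N%:R^-1 < dl.
  rewrite invf_plt ?posrE//; near: N; exact: nbhs_infty_gtr.
(* The sum has [N.+1] terms; the last one lies outside the left-endpoint rule and is estimated
   apart. *)
have Nf1 : N%:R^-1 * `|f 1| < e / 4.
  rewrite mulrC ltr_pdivrMr// mulrC -ltr_pdivrMr//; near: N; exact: nbhs_infty_gtr.
have := riemann_sum_approx (e := e / 4) N0 cf.
have fe x y : x \in `[0, 1] -> y \in `[0, 1] -> `|x - y| <= N%:R^-1 -> `|f x - f y| <= e / 4.
  by move=> x1 y1 xy; apply/ltW/dlP => //; exact: le_lt_trans Ndl.
move=> /(_ fe); rewrite big_ord_recr /= divff ?lt0r_neq0// mulrDr.
set I := Rintegral _ _ _; set S := N%:R^-1 * _ => IS.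
have -> : S + N%:R^-1 * f 1 - I = N%:R^-1 * f 1 - (I - S) by ring.
apply: le_lt_trans (ler_normB _ _) _.
by rewrite normrM (ger0_norm (ltW _)) ?invr_gt0//; lra.
Unshelve. all: by end_near. Qed.

End RiemannSum.

(** * From small squared deviation to small weighted means *)

Section Concentration.
Context {R : realType}.

(** Young's inequality in each term, with a free scale [s]. *)
Lemma sum_norm_le_sqr n (y : nat -> R) (s : R) : 0 < s ->
  \sum_(k < n) `|y k| <= (n%:R * s + s^-1 * \sum_(k < n) y k ^+ 2) / 2.
Proof.
move=> s0; rewrite mulr_natl -[X in _ *+ X]card_ord -sumr_const mulr_sumr -big_split /= mulr_suml.
apply: ler_sum => k _; rewrite -subr_ge0 -(real_normK (num_real (y k))).
have -> : (s + s^-1 * `|y k| ^+ 2) / 2 - `|y k| = s^-1 * (s - `|y k|) ^+ 2 / 2.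
  by field; rewrite lt0r_neq0.
by rewrite divr_ge0// mulr_ge0 ?sqr_ge0// invr_ge0 ltW.
Qed.

(** At the scale [s = eta / K] both terms of Young's inequality are of order [N s]; with
    [N.+1 <= 2 N] they sum to at most [3 N s / 2], below the [2 N s] needed. *)
Lemma weighted_mean_small (N : nat) (w y : nat -> R) (K eta : R) :
  (0 < N)%N -> 0 < K -> 0 < eta -> (forall k, (k <= N)%N -> `|w k| <= K) ->
  \sum_(k < N.+1) y k ^+ 2 <= N%:R * (eta / K) ^+ 2 ->
  `|N%:R^-1 * \sum_(k < N.+1) w k * y k| <= 2 * eta.
Proof.
move=> N0 K0 eta0 wK yN; have Nr0 : 0 < N%:R :> R by rewrite ltr0n.
have s0 : 0 < eta / K by rewrite divr_gt0.
rewrite normrM gtr0_norm ?invr_gt0// mulrC ler_pdivrMr//.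
apply: le_trans (ler_norm_sum _ _ _) _.
apply: (@le_trans _ _ (K * \sum_(k < N.+1) `|y k|)).
  rewrite mulr_sumr; apply: ler_sum => k _; rewrite normrM ler_wpM2r//.
  by apply: wK; rewrite -ltnS.
rewrite mulrC -ler_pdivlMr//; apply: le_trans (sum_norm_le_sqr _ _ s0) _.
have : (eta / K)^-1 * \sum_(k < N.+1) y k ^+ 2 <= N%:R * (eta / K).
  have -> : N%:R * (eta / K) = (eta / K)^-1 * (N%:R * (eta / K) ^+ 2).
    by field; rewrite !lt0r_neq0.
  by rewrite ler_pM2l ?invr_gt0.
have : N.+1%:R * (eta / K) <= 2 * N%:R * (eta / K).
  have N1 : 1 <= N%:R :> R by rewrite ler1n.
  by rewrite ler_pM2r// -[N.+1]addn1 natrD; lra.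
have -> : 2 * eta * N%:R / K = 2 * (N%:R * (eta / K)).
  by ring.
lra.
Qed.

Lemma unit_itv_continuous_bounded (psi : R -> R) : {within `[0, 1], continuous psi} ->
  exists2 K : R, 0 < K & forall x, x \in `[0, 1] -> `|psi x| <= K.
Proof.
move=> cpsi; have := continuous_compact cpsi (@segment_compact R 0 1).
move=> /compact_bounded [M [_ MP]]; exists (Num.max 1 (M + 1)).
  by rewrite lt_max ltr01.
move=> x x01; apply: MP; last by exists x.
by rewrite lt_max; apply/orP; right; lra.
Qed.

Lemma deviation_mean (Tm Tp : R) (psi : R -> R) (N : nat) (O : N.+1.-tuple R) :
  (1 < N)%N -> boundary_ok Tm Tp O ->
  \sum_(k < N.+1) psi (k%:R / N%:R) * tnth O k =
  \sum_(k < N.+1) psi (k%:R / N%:R) * deviation Tm Tp O k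
  + \sum_(k < N.+1) psi (k%:R / N%:R) * (Tm + k%:R / N%:R * (Tp - Tm)).
Proof.
move=> N1 bO; rewrite -big_split /=; apply: eq_bigr => k _; rewrite -mulrDr.
by rewrite -[X in tnth O X]inord_val (deviationE N1 bO)// -ltnS.
Qed.

End Concentration.

Theorem theorem2p8 (R : realType) (Tm Tp : R) (hTm : 0 < Tm) (hTp : 0 < Tp)
    (nu : forall N : nat, probability (N.+1.-tuple R) R)
    (hnu : forall N : nat, (2 <= N)%N -> opinion_invariant Tm Tp (nu N))
    (eps : R) (heps : 0 < eps)
    (psi : R -> R) (hpsi : {within `[0%R, 1%R], continuous psi}) :
  (fun N : nat =>
     nu N [set O | eps < `| N%:R^-1 * \sum_(k < N.+1) psi (k%:R / N%:R) * tnth O k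
                     - Rintegral (@lebesgue_measure R) `[0%R, 1%R]
                         (fun x => psi x * (Tm + x * (Tp - Tm))) | ])
    @ \oo --> 0%E.
Proof.
pose g x := psi x * (Tm + x * (Tp - Tm)).
have cg : {within `[0, 1], continuous g}.
  apply/subspace_continuousP => x x01; apply: cvgM.
    by have /subspace_continuousP := hpsi; exact.
  apply: cvg_within_filter; apply: cvgD; first exact: cvg_cst.
  by apply: cvgM; [exact: cvg_id|exact: cvg_cst].
have [K K0 psiK] := unit_itv_continuous_bounded hpsi.
(* The weighted deviation may use [2 eta = eps / 2], the Riemann sum the other half. [c] is the
   threshold per vertex of [weighted_mean_small], so the tail bound at level [N c] is [C / N]. *)
pose eta := eps / 4; have eta0 : 0 < eta by rewrite divr_gt0.
pose c := (eta / K) ^+ 2; have c0 : 0 < c by rewrite exprn_gt0// divr_gt0.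
pose C := 8 * (Tp - Tm) ^+ 2 / c.
apply: (@squeeze_cvge _ _ _ _ (cst 0%E) _ (fun N => (C * N%:R^-1)%:E)); last 2 first.
- exact: cvg_cst.
- apply: cvg_EFin; first exact: nearW.
  rewrite -[X in _ --> X](mulr0 C); apply: cvgM; first exact: cvg_cst.
  apply/gtr0_cvgV0; last exact: cvgr_idn.
  by near=> N; rewrite ltr0n; near: N; exact: nbhs_infty_gt.
near=> N; rewrite measure_ge0 /=.
have N1 : (1 < N)%N by near: N; exact: nbhs_infty_gt.
have N0 : (0 < N)%N by exact: ltnW.
have Nr0 : 0 < N%:R :> R by rewrite ltr0n.
have riemann : `|N%:R^-1 * \sum_(k < N.+1) g (k%:R / N%:R)
    - Rintegral (@lebesgue_measure R) `[0%R, 1%R] g| < eps / 2.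
  by near: N; apply: riemann_sum_cvg => //; rewrite divr_gt0.
set I := Rintegral _ _ _ in riemann *; set S := [set O | _].
pose tail := [set O : N.+1.-tuple R | N%:R * c < \sum_(k < N.+1) deviation Tm Tp O k ^+ 2].
pose B := [set O : N.+1.-tuple R | boundary_ok Tm Tp O].
have mB : measurable (~` B) by apply: measurableC; exact: measurable_boundary_ok.
have mtail : measurable tail.
  rewrite (_ : tail = (fun O => \sum_(k < N.+1) deviation Tm Tp O k ^+ 2) @^-1` `]N%:R * c, +oo[).
    by rewrite -[_ @^-1` _]setTI; apply: measurable_sqY.
  by apply/seteqP; split=> O /=; rewrite in_itv/= andbT.
have mS : measurable S.
  pose h (O : N.+1.-tuple R) := `|N%:R^-1 * \sum_(k < N.+1) psi (k%:R / N%:R) * tnth O k - I|.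
  rewrite (_ : S = h @^-1` `]eps, +oo[); last first.
    by apply/seteqP; split=> O /=; rewrite in_itv/= andbT.
  rewrite -[_ @^-1` _]setTI.
  have mh : measurable_fun setT h.
    apply: measurableT_comp => //; apply: measurable_funB => //.
    apply: measurable_funM => //; apply: measurable_sum => k.
    by apply: measurable_funM => //; exact: measurable_tnth.
  exact: mh.
(* With the right boundary values and outside the tail, the two errors of [eps / 2] add up to at
   most [eps]. *)
have subS : S `<=` ~` B `|` tail.
  move=> O SO; have [bO|] := pselect (boundary_ok Tm Tp O); [right|by left].
  rewrite /tail /= ltNge; apply/negP => small; move: SO; rewrite /S /=.
  rewrite (deviation_mean _ N1 bO) mulrDr -addrA; apply/negP; rewrite -leNgt.
  apply: le_trans (ler_normD _ _) _.
  have wK k : (k <= N)%N -> `|psi (k%:R / N%:R)| <= K.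
    move=> kN; apply: psiK; rewrite in_itv/= divr_ge0//=.
    by rewrite ler_pdivrMr// mul1r ler_nat.
  have := weighted_mean_small N0 K0 eta0 wK small.
  by rewrite /eta; move: riemann; rewrite /g; lra.
apply: (@le_trans _ _ (nu N (~` B `|` tail))).
  by apply: le_measure => //; rewrite inE//; exact: measurableU.
apply: le_trans (measureU2 _ mB mtail) _.
rewrite [X in (X + _)%E](boundary_null (hnu N N1)) add0e.
have Nc0 : 0 < N%:R * c by rewrite mulr_gt0.
apply: le_trans (deviation_tail N1 (hnu N N1) Nc0) _.
have -> : C * N%:R^-1 = 8 * (Tp - Tm) ^+ 2 / (N%:R * c).
  by rewrite /C; field; rewrite !lt0r_neq0.
exact: lexx.
Unshelve. all: by end_near. Qed.
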